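(* Let $n\ge1$ be an integer. For all $f,g\in C_b[0,\infty)$ and all $x\ge0$, $$|T(f,g;x)|\le\frac12\cdot osc_{M_n}(f)\cdot osc_{M_n}(g).$$
   Context: $C_b[0,\infty)$ is the set of continuous bounded real-valued functions on $[0,\infty)$. $M_n$ is the Mirakjan–Favard–Szász operator $M_n(f;x):=e^{-nx}\sum_{k=0}^\infty\frac{(nx)^k}{k!}f\left(\frac kn\right)$, $x\in[0,\infty)$, and $T(f,g;x):=M_n(fg;x)-M_n(f;x)M_n(g;x)$. The oscillation is $osc_{M_n}(f):=\sup\{|f(k/n)-f(l/n)|:0\le k<l<\infty\}$ ($k,l$ integers), and similarly for $g$. *)

(* Defs.v *)
From Stdlib Require Import Reals Factorial.
From Coquelicot Require Import Coquelicot.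

Open Scope R_scope.

(* A function on [0, infty) is represented by a total function [R -> R]; only
   its values on [0, infty) matter.  In particular continuity is relative to
   [0, infty), i.e. one-sided at 0. *)
Definition Cb (f : R -> R) : Prop :=
  continuous_on (fun x => 0 <= x) f /\
  exists B : R, forall x : R, 0 <= x -> Rabs (f x) <= B.

(* At x = 0 the convention [0 ^ 0 = 1] gives [Mn n f 0 = f 0]. *)
Definition Mn (n : nat) (f : R -> R) (x : R) : R :=
  exp (- (INR n * x)) *
  Series (fun k : nat => (INR n * x) ^ k / INR (fact k) * f (INR k / INR n)).

Definition T (n : nat) (f g : R -> R) (x : R) : R :=
  Mn n (fun t => f t * g t) x - Mn n f x * Mn n g x.

(* For bounded [f] the least upper bound is finite, so that the projection
   [real : Rbar -> R] loses nothing. *)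
Definition osc (n : nat) (f : R -> R) : R :=
  real (Lub_Rbar (fun y : R => exists k l : nat,
    (k < l)%nat /\ y = Rabs (f (INR k / INR n) - f (INR l / INR n)))).

(* Main.v *)
(** The weights [exp(-nx) (nx)^k / k!] form a probability distribution on [nat],
    so [T] is the covariance of the sequences [f(k/n)] and [g(k/n)].  A covariance
    [E(uv) - E u E v] equals [E((u - a)(v - E v))] for every constant [a].  If the
    values of [u] oscillate by at most [A], the midrange [a] of [u] gives
    [|u - a| <= A/2]; if those of [v] oscillate by at most [B], then
    [|v - E v| <= B]. *)

Require Import Defs.
From Stdlib Require Import Reals Factorial Lra Lia.
From Coquelicot Require Import Coquelicot.

Open Scope R_scope.

Lemma is_series_exp_weight (y : R) :
  is_series (fun k => exp (- y) * (y ^ k / INR (fact k))) 1.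
Proof.
  replace 1 with (exp (- y) * exp y)
    by (rewrite <- exp_plus, Rplus_opp_l; apply exp_0).
  apply (is_series_scal_l (V := R_NormedModule)).
  apply is_series_ext with (2 := is_exp_Reals y).
  intros k. rewrite pow_n_pow. reflexivity.
Qed.

Lemma Mn_weighted (n : nat) (f : R -> R) (x : R) :
  Mn n f x =
  Series (fun k => exp (- (INR n * x)) * ((INR n * x) ^ k / INR (fact k))
                   * f (INR k / INR n)).
Proof.
  unfold Mn. rewrite <- Series_scal_l.
  apply Series_ext; intros k; ring.
Qed.

Lemma osc_bound_midrange (u : nat -> R) (A : R) :
  (forall k l, Rabs (u k - u l) <= A) ->
  exists a, forall k, Rabs (u k - a) <= A / 2.
Proof.
  intros Hu.
  destruct (completeness (fun y => exists k, y = u k)) as [M [Mub Mleast]].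
  - exists (u 0%nat + A). intros y [k ->].
    generalize (Hu k 0%nat); intros H; apply Rabs_le_between in H; lra.
  - exists (u 0%nat), 0%nat; reflexivity.
  (* With [M] the supremum of [u], every value lies in [[M - A, M]]; the witness is the centre of
     this interval. *)
  - exists (M - A / 2). intros k. apply Rabs_le_between.
    assert (u k <= M) by (apply Mub; exists k; reflexivity).
    assert (M <= u k + A).
    { apply Mleast. intros y [l ->].
      generalize (Hu l k); intros H1; apply Rabs_le_between in H1; lra. }
    lra.
Qed.

Section Weighted_mean.

Variable w : nat -> R.
Hypothesis w_ge0 : forall k, 0 <= w k.
Hypothesis w_sum : is_series w 1.

Lemma is_series_weight_const (c : R) : is_series (fun k => w k * c) c.
Proof.
  generalize (is_series_scal_r c w 1 w_sum).
  now rewrite Rmult_1_l.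
Qed.

Lemma Rabs_weight_mul_le (u : nat -> R) (C : R) :
  (forall k, Rabs (u k) <= C) -> forall k, Rabs (w k * u k) <= w k * C.
Proof.
  intros Hu k. rewrite Rabs_mult, (Rabs_pos_eq (w k)) by auto.
  now apply Rmult_le_compat_l.
Qed.

Lemma ex_series_weighted (u : nat -> R) (C : R) :
  (forall k, Rabs (u k) <= C) -> ex_series (fun k => w k * u k).
Proof.
  intros Hu.
  apply (@ex_series_le R_AbsRing R_CompleteNormedModule)
    with (b := fun k => w k * C).
  - exact (Rabs_weight_mul_le u C Hu).
  - exists C; apply is_series_weight_const.
Qed.

Lemma Rabs_weighted_mean_le (u : nat -> R) (C : R) :
  (forall k, Rabs (u k) <= C) -> Rabs (Series (fun k => w k * u k)) <= C.
Proof.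
  intros Hu.
  assert (HC := is_series_weight_const C).
  (* Reading [C] as the mean of the constant sequence turns the bound into a termwise comparison of
     series. *)
  rewrite <- (is_series_unique _ _ HC).
  eapply Rle_trans.
  - apply Series_Rabs.
    apply (@ex_series_le R_AbsRing R_CompleteNormedModule)
      with (b := fun k => w k * C); [|now exists C].
    intros k. change (Rabs (Rabs (w k * u k)) <= w k * C).
    rewrite Rabs_Rabsolu. now apply Rabs_weight_mul_le.
  - apply Series_le; [|now exists C].
    intros k; split; [apply Rabs_pos | now apply Rabs_weight_mul_le].
Qed.

Lemma Rabs_weighted_covariance_le (u v : nat -> R) (A B : R) :
  (forall k l, Rabs (u k - u l) <= A) ->
  (forall k l, Rabs (v k - v l) <= B) ->
  Rabs (Series (fun k => w k * (u k * v k))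
        - Series (fun k => w k * u k) * Series (fun k => w k * v k))
    <= 1 / 2 * A * B.
Proof.
  intros Hu Hv.
  destruct (osc_bound_midrange u A Hu) as [a Ha].
  (* Bounded oscillation forces boundedness, by comparison with the value at index 0; hence all the
     weighted series below converge. *)
  assert (bounded : forall s C, (forall k l, Rabs (s k - s l) <= C) ->
            forall k : nat, Rabs (s k) <= C + Rabs (s 0%nat)).
  { intros s C Hs k.
    replace (s k) with ((s k - s 0%nat) + s 0%nat) by ring.
    eapply Rle_trans; [apply Rabs_triang|]. specialize (Hs k 0%nat). lra. }
  assert (Bu := bounded u A Hu). assert (Bv := bounded v B Hv).
  assert (Su := Series_correct _ (ex_series_weighted u _ Bu)).
  assert (Sv := Series_correct _ (ex_series_weighted v _ Bv)).
  assert (Suv : ex_series (fun k => w k * (u k * v k))).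
  { apply ex_series_weighted
      with (C := (A + Rabs (u 0%nat)) * (B + Rabs (v 0%nat))).
    intros k. rewrite Rabs_mult.
    apply Rmult_le_compat; auto using Rabs_pos. }
  apply Series_correct in Suv.
  set (m := Series (fun k => w k * v k)) in *.
  set (p := Series (fun k => w k * u k)) in *.
  set (q := Series (fun k => w k * (u k * v k))) in *.
  (* Since the weights sum to 1, [m - v k] is the mean over [l] of [v l - v k], and each of these is
     at most [B] in absolute value. *)
  assert (Hm : forall k, Rabs (v k - m) <= B).
  { intros k. rewrite Rabs_minus_sym.
    replace (m - v k) with (Series (fun l => w l * (v l - v k))).
    - apply Rabs_weighted_mean_le; auto.
    - apply is_series_unique.
      apply is_series_ext with (fun l => w l * v l - w l * v k).
      + intros l; simpl; ring.
      + apply (is_series_minus (V := R_NormedModule));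
          [exact Sv | apply is_series_weight_const]. }
  replace (q - p * m) with (Series (fun k => w k * ((u k - a) * (v k - m)))).
  - apply Rabs_weighted_mean_le. intros k.
    rewrite Rabs_mult. replace (1 / 2 * A * B) with (A / 2 * B) by field.
    apply Rmult_le_compat; auto using Rabs_pos.
  - apply is_series_unique.
    (* The added zero [m * a - a * m] gives the sum the shape of the expanded product: four series
       with sums [q], [p * m], [m * a] and [a * m]. *)
    replace (q - p * m) with ((q - p * m) - (m * a - a * m)) by ring.
    apply is_series_ext with
      (fun k => (w k * (u k * v k) - w k * u k * m)
                - (w k * v k * a - w k * (a * m))).
    + intros k; simpl; ring.
    + apply (is_series_minus (V := R_NormedModule));
        apply (is_series_minus (V := R_NormedModule)).
      * exact Suv.
      * exact (is_series_scal_r m _ p Su).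
      * exact (is_series_scal_r a _ m Sv).
      * apply is_series_weight_const.
Qed.

End Weighted_mean.

(** The covariance bound asks for all pairs of indices, while [osc] ranges over [k < l] only;
    symmetry and the diagonal case fill the gap. *)
Lemma le_osc (n : nat) (hn : (1 <= n)%nat) (f : R -> R) (hf : Cb f) (k l : nat) :
  Rabs (f (INR k / INR n) - f (INR l / INR n)) <= osc n f.
Proof.
  destruct hf as [_ [B HB]].
  assert (Hpt : forall i : nat, Rabs (f (INR i / INR n)) <= B).
  { intros i. apply HB, Rdiv_le_0_compat; [apply pos_INR | apply lt_0_INR; lia]. }
  assert (lt_case : forall i j : nat, (i < j)%nat ->
            Rabs (f (INR i / INR n) - f (INR j / INR n)) <= osc n f).
  { unfold osc. set (E := fun y : R => _).
    destruct (Lub_Rbar_correct E) as [Hub Hleast].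
    (* This excludes a supremum of [p_infty], which [real] would send to 0; membership of a point in
       [E] excludes [m_infty]. *)
    assert (Hfin : Rbar_le (Lub_Rbar E) (2 * B)).
    { apply Hleast. intros y (i & j & _ & ->). simpl.
      eapply Rle_trans; [apply Rabs_triang|]. rewrite Rabs_Ropp.
      generalize (Hpt i) (Hpt j); lra. }
    intros i j Hij.
    assert (H := Hub _ (ex_intro _ i (ex_intro _ j (conj Hij eq_refl)))).
    destruct (Lub_Rbar E); simpl in *; tauto. }
  destruct (Nat.lt_trichotomy k l) as [H|[->|H]].
  - now apply lt_case.
  - rewrite Rminus_diag, Rabs_R0.
    (* On the diagonal the claim is [0 <= osc n f], which the pair (0, 1) witnesses. *)
    eapply Rle_trans; [apply Rabs_pos | apply (lt_case 0%nat 1%nat); lia].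
  - rewrite Rabs_minus_sym. now apply lt_case.
Qed.

Theorem corollary6p3 (n : nat) (hn : (1 <= n)%nat) (f g : R -> R)
  (hf : Cb f) (hg : Cb g) (x : R) (hx : 0 <= x) :
  Rabs (T n f g x) <= 1 / 2 * osc n f * osc n g.
Proof.
  unfold T. rewrite !Mn_weighted.
  apply Rabs_weighted_covariance_le
    with (u := fun k => f (INR k / INR n)) (v := fun k => g (INR k / INR n)).
  - intros k. apply Rmult_le_pos; [left; apply exp_pos|].
    apply Rdiv_le_0_compat; [|apply INR_fact_lt_0].
    apply pow_le, Rmult_le_pos; [apply pos_INR | exact hx].
  - apply is_series_exp_weight.
  - now apply le_osc.
  - now apply le_osc.
Qed.
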